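(* Suppose $\mathbb{R}^m$ is endowed with the Euclidean norm $\|\cdot\|_2$, $\mathbb{R}^n$ is endowed with a norm $\|\cdot\|$, and $D(x,y)=\frac12\|x-y\|^2$. If $f(x)=\frac12\|Ax-b\|_2^2$ for some $A\in\mathbb{R}^{m\times n}$ and $b\in\mathbb{R}^m$, $X\subseteq\mathbb{R}^n$ is a convex cone, and $A(X)$ is a linear subspace that contains more than one point, then \[ \mu_{f,X,D}=\frac{1}{\|(A|X)^{-1}\|^2}. \]
   Context: Bregman distance: $D_f(y,x)=f(y)-f(x)-\langle\nabla f(x),y-x\rangle$. For nonempty $S\subseteq X$, $D_f(S,x):=\inf_{y\in S}D_f(y,x)$ and $D(S,x):=\inf_{y\in S}D(y,x)$. For $y\in X$, $Z_{f,X}(y):=\{x\in X: f(x)=f(y)\text{ and }\langle\nabla f(x)-\nabla f(y),x-y\rangle=0\}$. The relative strong convexity constant is \[ \mu_{f,X,D}:=\sup\{\mu\ge0:\ D_f(Z_{f,X}(y),x)\ge\mu\,D(Z_{f,X}(y),x)\text{ for all }x,y\in X\}. \] For a convex cone $C\subseteq\mathbb{R}^n$, \[ \|(A|C)^{-1}\|:=\sup_{v\in A(C),\,\|v\|_2\le1}\ \inf_{x\in C,\,Ax=v}\|x\|. \] *)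

(* Defs.v *)
From mathcomp Require Import all_boot all_order all_algebra.
From mathcomp Require Import all_classical all_reals all_analysis.

Set Implicit Arguments.
Unset Strict Implicit.
Unset Printing Implicit Defensive.

Import Order.TTheory GRing.Theory Num.Theory.
Import numFieldNormedType.Exports.

Local Open Scope classical_set_scope.
Local Open Scope ring_scope.

Section Euclidean.
Context {R : realType} {n : nat}.
Implicit Types u v x y : 'cV[R]_n.

Definition inner u v : R := \sum_(i < n) u i 0 * v i 0.

Definition norm2 v : R := Num.sqrt (inner v v).

(* The canonical norm on matrices is the sup norm, so an arbitrary norm on R^n
   is a function satisfying the norm axioms (nonnegativity follows). *)
Definition is_norm (N : 'cV[R]_n -> R) : Prop :=
  [/\ forall x y, N (x + y) <= N x + N y,
      forall (a : R) x, N (a *: x) = `|a| * N x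
    & forall x, N x = 0 -> x = 0].

(* Only positive multiples are required, so 0 need not belong to the cone. *)
Definition convex_cone (C : set 'cV[R]_n) : Prop :=
  convex_set C /\ forall (t : R) x, 0 < t -> C x -> C (t *: x).

Definition gradient (f : 'cV[R]_n -> R) x : 'cV[R]_n :=
  \col_(i < n) 'D_(delta_mx i 0) f x.

Definition bregman (f : 'cV[R]_n -> R) y x : R :=
  f y - f x - inner (gradient f x) (y - x).

(* The infimum over y in S of D y x, in that argument order; D need not be
   symmetric. *)
Definition dist_from (D : 'cV[R]_n -> 'cV[R]_n -> R) (S : set 'cV[R]_n) x :
    \bar R :=
  ereal_inf [set (D y x)%:E | y in S].

Definition Zset (f : 'cV[R]_n -> R) (X : set 'cV[R]_n) y : set 'cV[R]_n :=
  [set x | [/\ X x, f x = f y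
             & inner (gradient f x - gradient f y) (x - y) = 0]].

(* The supremum is taken in the extended reals, as the set may be unbounded. *)
Definition rel_strong_convexity (f : 'cV[R]_n -> R) (X : set 'cV[R]_n)
    (D : 'cV[R]_n -> 'cV[R]_n -> R) : \bar R :=
  ereal_sup [set mu%:E | mu in [set mu : R | 0 <= mu /\
    forall x y, X x -> X y ->
      (mu%:E * dist_from D (Zset f X y) x
         <= dist_from (bregman f) (Zset f X y) x)%E]].

End Euclidean.

(* The norm of (A|C)^-1, where N is the norm on the domain of A. *)
Definition inv_norm {R : realType} {m n : nat} (N : 'cV[R]_n -> R)
    (A : 'M[R]_(m, n)) (C : set 'cV[R]_n) : \bar R :=
  ereal_sup [set ereal_inf [set (N x)%:E | x in [set x | C x /\ A *m x = v]]
            | v in [set v | (mulmx A @` C) v /\ norm2 v <= 1]].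

(* Main.v *)
(* For f(x) = |Ax - b|^2 / 2 the Bregman distance is |A(y - x)|^2 / 2 and Z(y)
   is the fibre {z in X : Az = Ay}, so mu is admissible iff the squared distance
   from x in X to the fibre over Ay is at most |A(y - x)|^2 / mu. Write L for
   the norm of (A|X)^-1. If L < 1 / sqrt mu, then x + w lies in that fibre for a
   short preimage w in X of A(y - x), which belongs to the subspace A(X), so mu
   is admissible. Conversely, taking x in X close to 0 with Ax = 0 shows that an
   admissible mu > 0 satisfies L <= 1 / sqrt mu. Since 1 / 0 = +oo and
   1 / +oo = 0 in the extended reals, these two facts determine the supremum
   without first showing that L is positive and finite. *)
Require Import Defs.
From mathcomp Require Import all_boot all_order all_algebra.
From mathcomp Require Import all_classical all_reals all_analysis.
From mathcomp Require Import ring lra.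

Import Order.TTheory GRing.Theory Num.Theory.
Import numFieldNormedType.Exports.

Local Open Scope classical_set_scope.
Local Open Scope ring_scope.

(** * Euclidean inner product and norm *)

Lemma innerDl (R : realType) (n : nat) (u v w : 'cV[R]_n) :
  inner (u + v) w = inner u w + inner v w.
Proof.
by rewrite /inner -big_split; apply: eq_bigr => i _; rewrite mxE mulrDl.
Qed.

Lemma innerC (R : realType) (n : nat) (u v : 'cV[R]_n) :
  inner u v = inner v u.
Proof. by apply: eq_bigr => i _; rewrite mulrC. Qed.

Lemma innerZl (R : realType) (n : nat) (a : R) (u v : 'cV[R]_n) :
  inner (a *: u) v = a * inner u v.
Proof.
by rewrite /inner big_distrr /=; apply: eq_bigr => i _; rewrite mxE mulrA.
Qed.

Lemma innerDr (R : realType) (n : nat) (u v w : 'cV[R]_n) :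
  inner w (u + v) = inner w u + inner w v.
Proof. by rewrite innerC innerDl !(innerC _ _ w). Qed.

Lemma innerZr (R : realType) (n : nat) (a : R) (u v : 'cV[R]_n) :
  inner u (a *: v) = a * inner u v.
Proof. by rewrite innerC innerZl innerC. Qed.

Lemma innerBl (R : realType) (n : nat) (u v w : 'cV[R]_n) :
  inner (u - v) w = inner u w - inner v w.
Proof. by rewrite -scaleN1r innerDl innerZl mulN1r. Qed.

(** Expand [u] in the standard basis. The coefficients then match the coordinates of [gradient],
    which are derivatives along [delta_mx i 0]. *)
Lemma inner_mulmxl (R : realType) (m n : nat) (A : 'M[R]_(m, n))
    (u : 'cV[R]_n) (v : 'cV[R]_m) :
  inner (A *m u) v = \sum_(i < n) inner (A *m delta_mx i 0) v * u i 0.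
Proof.
rewrite {1}(matrix_sum_delta u) mulmx_sumr -[LHS]/(inner _ v).
under eq_bigr do rewrite big_ord1 -scalemxAr.
rewrite (big_morph (fun w => inner w v) (id1 := 0) (op1 := +%R)).
- by apply: eq_bigr => i _; rewrite innerZl mulrC.
- by move=> x y; rewrite innerDl.
- by rewrite /inner big1 // => i _; rewrite mxE mul0r.
Qed.

Lemma inner_ge0 (R : realType) (n : nat) (u : 'cV[R]_n) : 0 <= inner u u.
Proof. by apply: sumr_ge0 => i _; rewrite -expr2 sqr_ge0. Qed.

Lemma inner_eq0 (R : realType) (n : nat) (u : 'cV[R]_n) :
  inner u u = 0 -> u = 0.
Proof.
move=> u0; apply/matrixP => i j; rewrite (ord1 j) mxE.
have /psumr_eq0P : forall i : 'I_n, true -> 0 <= u i 0 * u i 0.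
  by move=> k _; rewrite -expr2 sqr_ge0.
by move=> /(_ u0 i isT)/eqP; rewrite -expr2 sqrf_eq0 => /eqP.
Qed.

Lemma sqr_norm2 (R : realType) (n : nat) (u : 'cV[R]_n) :
  norm2 u ^+ 2 = inner u u.
Proof. by rewrite sqr_sqrtr // inner_ge0. Qed.

Lemma norm2_ge0 (R : realType) (n : nat) (u : 'cV[R]_n) : 0 <= norm2 u.
Proof. exact: sqrtr_ge0. Qed.

Lemma norm2Z (R : realType) (n : nat) (a : R) (u : 'cV[R]_n) :
  norm2 (a *: u) = `|a| * norm2 u.
Proof.
by rewrite /norm2 innerZl innerZr mulrA -expr2 sqrtrM ?sqr_ge0 // sqrtr_sqr.
Qed.

Lemma norm2_eq0 (R : realType) (n : nat) (u : 'cV[R]_n) :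
  norm2 u = 0 -> u = 0.
Proof. by move=> u0; apply: inner_eq0; rewrite -sqr_norm2 u0 expr0n. Qed.

Lemma is_norm_ge0 (R : realType) (n : nat) (N : 'cV[R]_n -> R) :
  is_norm N -> forall x, 0 <= N x.
Proof.
move=> [ND NZ _] x; have := ND x (- x); have N0 := NZ 0 0.
rewrite subrr -scaleN1r NZ normrN1 mul1r -(scale0r (0 : 'cV[R]_n)) N0 normr0 mul0r.
by rewrite -mulr2n pmulrn_lge0.
Qed.

(** The sum is twice the midpoint, which lies in [X] by convexity. *)
Lemma convex_cone_add (R : realType) (n : nat) (X : set 'cV[R]_n) :
  convex_cone X -> forall x y, X x -> X y -> X (x + y).
Proof.
move=> [Xc Xt] x y Xx Xy.
have h01 : (0 <= 2^-1 :> R) && (2^-1 <= 1 :> R) by lra.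
have := Xc x y (Itv01 (proj1 (andP h01)) (proj2 (andP h01))).
rewrite !inE => /(_ Xx Xy)/(Xt 2 _ (ltr0Sn _ _)).
congr (X _); rewrite /conv /= scalerDr !scalerA.
have -> : 2 * (1 - 2^-1) = 1 :> R by lra.
by rewrite mulfV ?pnatr_eq0 // !scale1r.
Qed.

(** * Gradient, Bregman distance and fibres of the least-squares function *)

Section LeastSquares.
Context {R : realType} {m n : nat} (A : 'M[R]_(m, n)) (b : 'cV[R]_m).
Context (f : 'cV[R]_n -> R).
Context (hf : forall x, f x = 2^-1 * norm2 (A *m x - b) ^+ 2).

(** The second-order expansion of a quadratic is exact; it yields both the derivative and the
    Bregman distance. *)
Lemma least_squaresD x v :
  f (v + x) = f x + inner (A *m v) (A *m x - b)
    + 2^-1 * inner (A *m v) (A *m v).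
Proof.
rewrite !hf !sqr_norm2 mulmxDr -addrA; move: (A *m x - b) => r.
by rewrite innerDl !innerDr (innerC _ _ r (A *m v)); field.
Qed.

Lemma derive_least_squares x v :
  'D_v f x = inner (A *m v) (A *m x - b).
Proof.
rewrite /derive; apply: cvg_lim => //.
set c := inner _ _; set d := inner (A *m v) (A *m v).
(* Away from [h = 0] the difference quotient is exactly this affine function of [h]. *)
apply: (@cvg_trans _ ((fun h : R => c + h * (2^-1 * d)) @ 0^')).
  apply: near_eq_cvg; near=> h.
  have h0 : h != 0 by near: h; exact: nbhs_dnbhs_neq.
  rewrite /= least_squaresD -scalemxAr !innerZl innerZr -/c -/d.
  by rewrite /GRing.scale /=; field.
have : c + h * (2^-1 * d) @[h --> (0 : R)^'] --> c + 0 * (2^-1 * d).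
  apply: cvgD; first exact: cvg_cst.
  apply: cvgM; [exact: cvg_within | exact: cvg_cst].
by rewrite mul0r addr0.
Unshelve. all: by end_near. Qed.

Lemma inner_gradient_least_squares x w :
  inner (gradient f x) w = inner (A *m w) (A *m x - b).
Proof.
rewrite inner_mulmxl; apply: eq_bigr => i _.
by rewrite mxE derive_least_squares.
Qed.

Lemma bregman_least_squares y x :
  bregman f y x = 2^-1 * norm2 (A *m (y - x)) ^+ 2.
Proof.
rewrite /bregman inner_gradient_least_squares -[in f y](subrK x y).
by rewrite least_squaresD sqr_norm2; ring.
Qed.

(** Pairing the gradient difference with [x - y] gives |A(x - y)|^2, so its vanishing forces Ax =
    Ay; equality of the values of [f] then follows. *)
Lemma Zset_least_squares (X : set 'cV[R]_n) y :
  Zset f X y = [set x | X x /\ A *m x = A *m y].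
Proof.
apply/seteqP; split=> x /= [Xx].
  move=> _; rewrite innerBl !inner_gradient_least_squares => h; split=> //.
  apply/eqP; rewrite -subr_eq0 -mulmxBr; apply/eqP/inner_eq0.
  rewrite -[RHS]h {2}(_ : A *m (x - y) = (A *m x - b) - (A *m y - b)).
    by rewrite innerC innerBl !(innerC _ _ (A *m (x - y))).
  by rewrite mulmxBr opprB addrA subrK.
move=> Axy; split=> //; first by rewrite !hf Axy.
rewrite innerBl !inner_gradient_least_squares Axy.
by rewrite subrr.
Qed.

End LeastSquares.

(** * Admissible constants and the norm of the inverse *)

Definition rel_strongly_convex {R : realType} {n : nat} (f : 'cV[R]_n -> R)
    (X : set 'cV[R]_n) (D : 'cV[R]_n -> 'cV[R]_n -> R) (mu : R) : Prop :=
  forall x y, X x -> X y ->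
    (mu%:E * dist_from D (Zset f X y) x
       <= dist_from (bregman f) (Zset f X y) x)%E.

Section InverseNorm.
Context {R : realType} {m n : nat} (N : 'cV[R]_n -> R).
Context (D : 'cV[R]_n -> 'cV[R]_n -> R) (A : 'M[R]_(m, n)) (b : 'cV[R]_m).
Context (f : 'cV[R]_n -> R) (X : set 'cV[R]_n).
Context (hN : is_norm N).
Context (hD : forall x y, D x y = 2^-1 * N (x - y) ^+ 2).
Context (hf : forall x, f x = 2^-1 * norm2 (A *m x - b) ^+ 2).
Context (hX : convex_cone X).
Context (hAX : submod_closed (mem (mulmx A @` X))).

(** A point of the kernel inside [X] serves as a substitute for 0, which may lie outside [X]. *)
Lemma image_cone0 : exists2 x, X x & A *m x = 0.
Proof. by case: hAX => /set_mem[x Xx Ax0] _; exists x. Qed.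

Lemma image_coneB x y : X x -> X y -> (mulmx A @` X) (A *m (y - x)).
Proof.
move=> Xx Xy; case: hAX => _ /(_ (-1) (A *m x) (A *m y)) h.
have /set_mem := h (mem_set (imageP _ Xx)) (mem_set (imageP _ Xy)).
by rewrite scaleN1r mulmxBr addrC.
Qed.

(** The Bregman distance depends on its first argument only through its image under [A], so it is
    constant on the fibre; [X y] makes the fibre nonempty. *)
Lemma dist_from_bregman x y : X y ->
  dist_from (bregman f) (Zset f X y) x
    = (2^-1 * norm2 (A *m (y - x)) ^+ 2)%:E.
Proof.
move=> Xy; rewrite /dist_from (Zset_least_squares A b f hf).
rewrite -[RHS]ereal_inf1; congr ereal_inf; apply/seteqP; split.
  move=> _ [z [_ Az] <-] /=.
  by rewrite (bregman_least_squares A b f hf) !mulmxBr Az.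
by move=> _ -> /=; exists y => //; rewrite (bregman_least_squares A b f hf).
Qed.

Lemma rel_strongly_convex0 : rel_strongly_convex f X D 0.
Proof.
move=> x y Xx Xy; rewrite mul0e dist_from_bregman // lee_fin.
by rewrite mulr_ge0 ?sqr_ge0 // invr_ge0.
Qed.

Lemma inv_norm_ge0 : (0 <= inv_norm N A X)%E.
Proof.
have [x Xx Ax0] := image_cone0.
apply: ereal_sup_ge; eexists.
  (* The vector 0 belongs to A(X), so the supremum has a nonnegative member. *)
  exists 0 => //; split; first by exists x.
  by rewrite -(scale0r 0) norm2Z normr0 mul0r.
by apply: le_ereal_inf_tmp => _ [z _ <-]; rewrite lee_fin is_norm_ge0.
Qed.

(* The bound is tested at base points [t *: x0] with [A x0 = 0], letting [t]
   tend to 0, because [X] need not contain 0. *)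
Lemma inv_norm_le mu : 0 < mu -> rel_strongly_convex f X D mu ->
  (inv_norm N A X <= ((Num.sqrt mu)^-1)%:E)%E.
Proof.
move=> mu0 sc; have s0 : 0 < Num.sqrt mu by rewrite sqrtr_gt0.
apply: ge_ereal_sup => _ [_ [[y Xy <-] Ay1] <-].
apply/lee_addgt0Pr => e e0.
have [x0 Xx0 Ax0] := image_cone0.
have Nx0 := is_norm_ge0 _ _ _ hN x0.
(* This makes the norm of [t *: x0] at most e / 2; the added 1 keeps the denominator positive when
   [N x0 = 0]. *)
pose t := e / 2 / (N x0 + 1).
have t0 : 0 < t by rewrite !divr_gt0 // ltr_wpDl.
have tN : t * N x0 <= e / 2.
  rewrite /t mulrAC ler_pdivrMr ?ltr_wpDl //.
  by rewrite ler_wpM2l ?divr_ge0 ?ltW // ltrDl.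
have Xt : X (t *: x0) by apply: hX.2.
have := sc _ _ Xt Xy; rewrite dist_from_bregman // -lee_pdivlMl //.
set s := Num.sqrt mu in s0 *.
have se0 : 0 < s^-1 + e / 2 by rewrite addr_gt0 ?divr_gt0 ?invr_gt0.
(* The shift [t *: x0] is in the kernel and |Ay| <= 1. The slack e / 2 makes the bound strict, so
   some point [z] of the fibre lies below it, even if the infimum is not attained. *)
have Hb : (((mu^-1)%:E * (2^-1 * norm2 (A *m (y - t *: x0)) ^+ 2)%:E)%E
    < (2^-1 * (s^-1 + e / 2) ^+ 2)%:E)%E.
  rewrite -EFinM lte_fin mulrCA ltr_pM2l ?invr_gt0 //.
  rewrite mulmxBr -scalemxAr Ax0 scaler0 subr0.
  have -> : mu^-1 = s^-1 ^+ 2 by rewrite exprVn sqr_sqrtr // ltW.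
  rewrite -exprMn ltr_pXn2r ?nnegrE ?(ltW se0) //; last first.
    by rewrite mulr_ge0 ?norm2_ge0 // invr_ge0 ltW.
  apply: le_lt_trans (_ : s^-1 < _); last by rewrite ltrDl divr_gt0.
  by rewrite ger_pMr // invr_gt0.
move=> /le_lt_trans/(_ Hb)/ereal_inf_lt[_ [z + <-]].
rewrite (Zset_least_squares A b f hf) lte_fin hD => -[Xz Az].
rewrite ltr_pM2l ?invr_gt0 // ltr_pXn2r ?nnegrE ?is_norm_ge0 ?(ltW se0) //.
move=> Nz; apply: ereal_inf_le; exists (N z)%:E; first by exists z.
rewrite -EFinD lee_fin; case: (hN) => ND NZ _.
have := ND (z - t *: x0) (t *: x0); rewrite subrK NZ gtr0_norm //.
by move: Nz tN; lra.
Qed.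

(** By homogeneity: normalise [w], take a nearly minimal preimage of the unit vector, and scale
    back. The strict bound on the supremum replaces attainment of the infimum. *)
Lemma inv_norm_lt_preimage (r : R) w : (inv_norm N A X < r%:E)%E ->
  (mulmx A @` X) w -> w != 0 ->
  exists x, [/\ X x, A *m x = w & N x < norm2 w * r].
Proof.
move=> Lr AXw w0.
have nw0 : 0 < norm2 w.
  rewrite lt_neqAle norm2_ge0 andbT eq_sym.
  by apply: contra_neq w0 => /norm2_eq0.
have : (ereal_inf [set (N x)%:E | x in
    [set x | X x /\ A *m x = (norm2 w)^-1 *: w]] < r%:E)%E.
  apply: le_lt_trans Lr; apply: ereal_sup_ubound; eexists; split=> //.
    case: AXw => x Xx Ax; exists ((norm2 w)^-1 *: x).
      by apply: hX.2 => //; rewrite invr_gt0.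
    by rewrite -scalemxAr Ax.
  by rewrite norm2Z gtr0_norm ?invr_gt0 // mulVf // gt_eqF.
move=> /ereal_inf_lt[_ [x [Xx Ax] <-]]; rewrite lte_fin => Nx.
exists (norm2 w *: x); split; first exact: hX.2.
  by rewrite -scalemxAr Ax scalerA mulfV ?gt_eqF // scale1r.
by case: (hN) => _ NZ _; rewrite NZ gtr0_norm // ltr_pM2l.
Qed.

Lemma inv_norm_lt mu : 0 < mu ->
  (inv_norm N A X < ((Num.sqrt mu)^-1)%:E)%E -> rel_strongly_convex f X D mu.
Proof.
move=> mu0 Lmu x y Xx Xy; rewrite dist_from_bregman // -lee_pdivlMl //.
rewrite /dist_from (Zset_least_squares A b f hf); apply: ereal_inf_le.
(* A zero difference cannot be normalised, but then [x] itself lies in the fibre over Ay, at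
   distance 0. *)
have [Axy|Axy] := eqVneq (A *m (y - x)) 0.
  exists (D x x)%:E.
    exists x => //; split=> //; apply/eqP; rewrite eq_sym -subr_eq0 -mulmxBr.
    exact/eqP.
  case: (hN) => _ NZ _.
  rewrite hD subrr -(scale0r 0) NZ normr0 mul0r expr0n mulr0 lee_fin.
  by rewrite mulr_ge0 ?invr_ge0 ?(ltW mu0) // mulr_ge0 ?sqr_ge0 ?invr_ge0.
have [w [Xw Aw Nw]] := inv_norm_lt_preimage _ _ Lmu (image_coneB _ _ Xx Xy) Axy.
exists (D (w + x) x)%:E.
  exists (w + x) => //; split; first exact: convex_cone_add.
  by rewrite mulmxDr Aw mulmxBr subrK.
rewrite hD addrK -EFinM lee_fin [leRHS]mulrCA ler_pM2l ?invr_gt0 //.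
have -> : mu^-1 = (Num.sqrt mu)^-1 ^+ 2 by rewrite exprVn sqr_sqrtr // ltW.
rewrite mulrC -exprMn ler_pXn2r ?nnegrE ?is_norm_ge0 ?(ltW Nw) //.
by rewrite mulr_ge0 ?norm2_ge0 // invr_ge0 sqrtr_ge0.
Qed.

End InverseNorm.

Theorem corollary1 (R : realType) (m n : nat) (N : 'cV[R]_n -> R)
    (D : 'cV[R]_n -> 'cV[R]_n -> R) (A : 'M[R]_(m, n)) (b : 'cV[R]_m)
    (f : 'cV[R]_n -> R) (X : set 'cV[R]_n)
    (hN : is_norm N)
    (hD : forall x y, D x y = 2^-1 * N (x - y) ^+ 2)
    (hf : forall x, f x = 2^-1 * norm2 (A *m x - b) ^+ 2)
    (hX : convex_cone X)
    (hAX : submod_closed (mem (mulmx A @` X)))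
    (hAX2 : exists u v, [/\ (mulmx A @` X) u, (mulmx A @` X) v & u <> v]) :
  (rel_strong_convexity f X D = 1 / (inv_norm N A X) ^+ 2)%E.
Proof.
have sc0 : rel_strongly_convex f X D 0.
  exact: (rel_strongly_convex0 D A b f X hf).
have scL := inv_norm_le N D A b f X hN hD hf hX hAX.
have Lsc := inv_norm_lt N D A b f X hN hD hf hX hAX.
have le_sup mu : 0 <= mu -> rel_strongly_convex f X D mu ->
    (mu%:E <= rel_strong_convexity f X D)%E.
  by move=> mu0 sc; apply: ereal_sup_ubound; exists mu.
have sup_le c : (0 <= c)%E ->
    (forall mu, 0 < mu -> rel_strongly_convex f X D mu -> (mu%:E <= c)%E) ->
    (rel_strong_convexity f X D <= c)%E.
  move=> c0 h; apply: ge_ereal_sup => _ [mu [/= mu0 sc] <-].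
  by move: mu0; rewrite le0r => /orP[/eqP->//|mu0]; exact: h.
have := inv_norm_ge0 N A X hN hAX.
move: (inv_norm N A X) scL Lsc => [r||//] scL Lsc; last first.
  (* Infinite norm: a positive admissible [mu] would bound it by 1 / sqrt mu, so only 0 is
     admissible. *)
  move=> _; rewrite expe2 mulyy invey mule0.
  apply/eqP; rewrite eq_le le_sup // andbT.
  by apply: sup_le => // mu mu0 /(scL _ mu0); rewrite leye_eq.
rewrite lee_fin le_eqVlt => /orP[/eqP r0|r0].
  (* Zero norm: every positive [mu] is admissible, and the supremum is +oo, the value of 1 / 0. *)
  rewrite -r0 expe2 mul0e inve0 mul1e; apply/eqyP => mu mu0.
  by apply: le_sup (ltW mu0) _; apply: Lsc => //;
    rewrite -r0 lte_fin invr_gt0 sqrtr_gt0.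
(* With [mu] written this way, comparing it with [r ^- 2] amounts to comparing 1 / sqrt mu with
   [r]. *)
have sqrtVX (mu : R) : 0 < mu -> mu = (Num.sqrt mu)^-1 ^- 2.
  by move=> mu0; rewrite exprVn invrK sqr_sqrtr // ltW.
rewrite -EFin_expe inver expf_eq0 gt_eqF //= mul1e; apply/eqP; rewrite eq_le.
apply/andP; split.
  apply: sup_le => [|mu mu0 sc]; first by rewrite lee_fin invr_ge0 sqr_ge0.
  have := scL _ mu0 sc; rewrite !lee_fin => h; rewrite (sqrtVX mu mu0).
  have s0 : 0 < (Num.sqrt mu)^-1 by rewrite invr_gt0 sqrtr_gt0.
  by rewrite lef_pV2 ?posrE ?exprn_gt0 // ler_pXn2r ?nnegrE ?(ltW r0) ?(ltW s0).
(* Admissibility is known only under a strict inequality, so the lower bound is tested at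
   [r ^- 2 - e]; when this is not positive, the admissible constant 0 suffices. *)
apply/lee_subgt0Pr => e e0; rewrite -EFinB.
have [mu0|mu0] := leP (r ^- 2 - e) 0.
  by apply: le_trans (le_sup _ (lexx 0) sc0).
apply: le_sup (ltW mu0) _; apply: Lsc => //; rewrite lte_fin.
have s0 : 0 < (Num.sqrt (r ^- 2 - e))^-1 by rewrite invr_gt0 sqrtr_gt0.
rewrite -(ltr_pXn2r (n := 2)) ?nnegrE ?(ltW r0) ?(ltW s0) //.
rewrite -ltf_pV2 ?posrE ?exprn_gt0 //.
by rewrite -sqrtVX // ltrBlDr ltrDl.
Qed.
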